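(* In the additive growth curve model $Y_n=\sum_{i=1}^kX_i\Theta_iZ_i'+\mathcal E$ with orthogonal design matrices (as specified in the context), the statistic $$\widehat\Sigma(Y_n)=Y_n'WY_n,\qquad W=\frac1r\Bigl(I-\sum_{i=1}^kP_{X_i}\Bigr),\quad r=n-\sum_{i=1}^k\operatorname{rank}(X_i),$$ is a consistent estimator of the covariance matrix $\Sigma$; that is, $\widehat\Sigma(Y_n)$ converges in probability to $\Sigma$ as $n\to\infty$.
   Context: Model. For each sample size $n$, $Y_n$ is an $n\times p$ random matrix of observations with $Y_n=\sum_{i=1}^kX_i\Theta_iZ_i'+\mathcal E$. For $1\le i\le k$, $X_i$ (depending on $n$) is a known $n\times m_i$ design matrix ($n>m_i$) of full rank $m_i$, $Z_i$ is a known $p\times q_i$ profile matrix ($p>q_i$) of full rank $q_i$, and $\Theta_i$ is an unknown $m_i\times q_i$ matrix of regression coefficients; $k,p,m_i,q_i,Z_i,\Theta_i$ do not depend on $n$. The $n\times p$ error matrix $\mathcal E$ (depending on $n$) has a general continuous type distribution; its rows are independent and identically distributed with mean zero and common unknown $p\times p$ covariance matrix $\Sigma$. The design matrices satisfy $\operatorname{rank}(X_i)+p\le n$ for all $i$ and $X_i'X_j=\mathbf 0$ for all distinct $i,j$. As $n$ grows, new rows are added to the matrices $X_i$ (and to $Y_n,\mathcal E$), earlier rows remaining intact. Notation. $A'$ is the transpose, and $P_A=A(A'A)^-A'$ is the orthogonal projection onto the column space of $A$. *)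

(* Defs.v *)
From HB Require Import structures.
From mathcomp Require Export all_boot all_order all_algebra.
From mathcomp Require Export finmap.
From mathcomp Require Export all_classical all_reals all_analysis.
Export Order.TTheory GRing.Theory Num.Theory.
Export numFieldNormedType.Exports.

Set Implicit Arguments.
Unset Strict Implicit.
Unset Printing Implicit Defensive.

Local Open Scope classical_set_scope.
Local Open Scope ring_scope.

(* Matrices with the Borel sigma-algebra of their (entrywise) topology. *)
Notation borel_mx R m n := (g_sigma_algebraType (@open 'M[R]_(m, n))).

(* n-dimensional Lebesgue measure on Borel sets, by Cavalieri's principle:
   integrate over the first coordinate the measure of the slices. *)
Fixpoint lebesgue_rV (R : realType) (n : nat) : set 'rV[R]_n -> \bar R :=
  match n with
  | 0 => fun A => (\1_A (0 : 'rV[R]_0))%:E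
  | n'.+1 => fun A =>
      (\int[@lebesgue_measure R]_x
         lebesgue_rV [set v : 'rV[R]_n' | A (row_mx x%:M v)])%E
  end.

Definition lebesgue_mx (R : realType) (m n : nat) (A : set 'M[R]_(m, n)) :
    \bar R :=
  lebesgue_rV [set v | A (vec_mx v)].

Section RandomMatrices.
Context (R : realType) (d : measure_display) (T : measurableType d).
Context (P : probability T R) (m n : nat).

(* Absolute continuity with respect to Lebesgue measure (equivalently, by
   Radon-Nikodym, existence of a density). *)
Definition continuous_type (X : T -> 'M[R]_(m, n)) : Prop :=
  forall B : set (borel_mx R m n), measurable B ->
    lebesgue_mx B = 0%E -> P (X @^-1` B) = 0%E.

Definition mutually_independent (I : choiceType)
    (X : I -> T -> 'M[R]_(m, n)) : Prop :=
  forall (J : {fset I}) (B : I -> set (borel_mx R m n)),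
    (forall i, measurable (B i)) ->
    P (\bigcap_(i in [set` J]) X i @^-1` B i)
      = (\prod_(i <- J) P (X i @^-1` B i))%E.

Definition identically_distributed (I : Type)
    (X : I -> T -> 'M[R]_(m, n)) : Prop :=
  forall (i j : I) (B : set (borel_mx R m n)), measurable B ->
    P (X i @^-1` B) = P (X j @^-1` B).

Definition cvg_in_probability (X : nat -> T -> 'M[R]_(m, n))
    (L : 'M[R]_(m, n)) : Prop :=
  forall e : R, 0 < e ->
    P [set w | e < `|X N w - L|] @[N --> \oo] --> 0%E.

End RandomMatrices.

(* [pinvmx] is a generalized inverse (G *m pinvmx G *m G = G, by [mulmxKpV]),
   and the product below does not depend on which one is chosen. *)
Definition col_proj (R : realType) (n m : nat) (A : 'M[R]_(n, m)) : 'M[R]_n :=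
  A *m pinvmx (A^T *m A) *m A^T.

Section SigmaHat.
Context (R : realType) (n p k : nat) (m : 'I_k -> nat).
Context (X : forall i, 'M[R]_(n, m i)).

Definition resid_df : R := n%:R - \sum_i (\rank (X i))%:R.

Definition resid_W : 'M[R]_n := resid_df^-1 *: (1%:M - \sum_i col_proj (X i)).

Definition Sigma_hat (Y : 'M[R]_(n, p)) : 'M[R]_p := Y^T *m resid_W *m Y.

End SigmaHat.

(* Matrices that grow with the sample size are given by an infinite sequence of
   rows, the n-th matrix consisting of the first n of them. *)
Definition first_rows (R : realType) (m : nat) (x : nat -> 'rV[R]_m) (n : nat) :
    'M[R]_(n, m) :=
  \matrix_(t < n) x t.

Definition response (R : realType) (n p k : nat) (m q : 'I_k -> nat)
    (X : forall i, 'M[R]_(n, m i)) (Theta : forall i, 'M[R]_(m i, q i))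
    (Z : forall i, 'M[R]_(p, q i)) (E : 'M[R]_(n, p)) : 'M[R]_(n, p) :=
  \sum_i X i *m Theta i *m (Z i)^T + E.

(* Main.v *)
From HB Require Import structures.
Require Import Defs.
From mathcomp Require Import measurable_realfun ring lra.

Set Implicit Arguments.
Unset Strict Implicit.
Unset Printing Implicit Defensive.

Local Open Scope classical_set_scope.
Local Open Scope ring_scope.

(** Let H be the sum of the orthogonal projections onto the column spaces of
    the design matrices.  Orthogonality of the designs makes H symmetric and
    idempotent, with trace M, the total number of design columns, and H fixes
    every design matrix.  So I - H annihilates the mean of the observations from
    both sides, and the estimator depends on the errors E only
    ([Sigma_hat_error]):

      Sigma_hat = (n - M)^-1 (E' E - E' H E).

    Here M does not depend on n, so two facts suffice.

    The entries of E' E are sums of n independent, identically distributed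
    integrable variables, namely products of two coordinates of an error row,
    with mean the entry of Sigma.  As only second moments of the errors are
    available, these products need not have a variance; their averages
    converge in probability by the weak law of large numbers under a first
    moment ([weak_law]).

    The entries of E' H E are negligible after division by n.  With F = H E one
    has E' H E = F' F, so each entry is dominated by the mean of two diagonal
    entries ([gram_entry_le]), and these are nonnegative.  Since distinct error
    rows are uncorrelated, the diagonal entry j has expectation
    Sigma_jj tr H = Sigma_jj M, which is bounded in n, and Markov's inequality
    applies.

    The same computation of the expectation of a quadratic form
    ([quadratic_form_expectation]) serves twice: with H as above, and with the
    all-ones matrix, whose quadratic form is the square of a sum and which
    therefore gives the variance bound inside the weak law.  It rests on the
    product rule E[g(U) h(V)] = E[g(U)] E[h(V)] for independent U and V
    ([Rintegral_mul_indep]), obtained from Fubini's theorem. *)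

(** * Projections onto the columns of the design matrices *)

Lemma mulmx_tr_eq0 (R : realFieldType) n (u : 'rV[R]_n) : u *m u^T = 0 -> u = 0.
Proof.
move=> /matrixP /(_ 0 0); rewrite !mxE => u0.
apply/rowP => j; rewrite mxE.
have sq i : 0 <= u 0 i * u^T i 0 by rewrite mxE -expr2 sqr_ge0.
have /(_ j isT) := psumr_eq0P (fun i _ => sq i) u0.
by rewrite mxE -expr2 => /eqP; rewrite sqrf_eq0 => /eqP.
Qed.

(** A row u killed by A' A satisfies (u A') (u A')' = 0, so u A' = 0 over a real
    field, and the rows of A' are independent. *)
Lemma gram_unitmx (R : realFieldType) n m (A : 'M[R]_(n, m)) :
  \rank A = m -> A^T *m A \in unitmx.
Proof.
move=> rA; have fA : row_free A^T by rewrite /row_free mxrank_tr rA.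
rewrite -row_free_unit -kermx_eq0; apply/eqP/row_matrixP => i.
rewrite row0; set u := row i _.
have uA : u *m (A^T *m A) = 0.
  by apply/sub_kermxP; exact: row_sub.
apply: (row_free_inj fA); rewrite mul0mx; apply: mulmx_tr_eq0.
by rewrite trmx_mul trmxK mulmxA -(mulmxA u) uA mul0mx.
Qed.

Section ColProj.
Context (R : realType) (n m : nat) (A : 'M[R]_(n, m)).
Hypothesis rA : \rank A = m.

Lemma col_projE : col_proj A = A *m invmx (A^T *m A) *m A^T.
Proof. by rewrite /col_proj pinvmxE // gram_unitmx. Qed.

Lemma col_proj_id : col_proj A *m A = A.
Proof. by rewrite col_projE -!mulmxA mulVmx ?gram_unitmx ?mulmx1. Qed.

Lemma tr_col_proj : (col_proj A)^T = col_proj A.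
Proof.
by rewrite col_projE !trmx_mul trmxK trmx_inv trmx_mul trmxK mulmxA.
Qed.

Lemma mxtrace_col_proj : \tr (col_proj A) = m%:R.
Proof.
by rewrite col_projE mxtrace_mulC mulmxA mulmxV ?gram_unitmx // mxtrace1.
Qed.

End ColProj.

Section SumProj.
Context (R : realType) (n k : nat) (m : 'I_k -> nat).
Context (X : forall i, 'M[R]_(n, m i)).
Hypothesis rX : forall i, \rank (X i) = m i.
Hypothesis orthX : forall i j, i != j -> (X i)^T *m X j = 0.
Let H := \sum_i col_proj (X i).

Lemma sum_col_proj_id j : H *m X j = X j.
Proof.
rewrite /H mulmx_suml (bigD1 j) //= col_proj_id // big1 ?addr0 // => i ij.
by rewrite /col_proj -mulmxA (orthX ij) mulmx0.
Qed.

Lemma tr_sum_col_proj : H^T = H.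
Proof. by rewrite /H raddf_sum; apply: eq_bigr => i _; exact: tr_col_proj. Qed.

Lemma sum_col_proj_idem : H *m H = H.
Proof.
rewrite {2}/H mulmx_sumr; apply: eq_bigr => i _.
by rewrite /col_proj !mulmxA sum_col_proj_id.
Qed.

Lemma mxtrace_sum_col_proj : \tr H = (\sum_i m i)%:R.
Proof.
rewrite /H raddf_sum natr_sum; apply: eq_bigr => i _.
exact: mxtrace_col_proj.
Qed.

(** The mean of the observations lies in the span of the designs, which
    I - H annihilates from the left and, being symmetric, from the right. *)
Lemma Sigma_hat_error p (q : 'I_k -> nat) (Theta : forall i, 'M[R]_(m i, q i))
    (Z : forall i, 'M[R]_(p, q i)) (E : 'M[R]_(n, p)) :
  Sigma_hat X (response X Theta Z E) =
  (n%:R - (\sum_i m i)%:R)^-1 *: (E^T *m E - E^T *m H *m E).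
Proof.
have K0 j : (1%:M - H) *m X j = 0.
  by rewrite mulmxBl mul1mx sum_col_proj_id subrr.
rewrite /Sigma_hat /resid_W -/H /resid_df.
rewrite (eq_bigr (fun i => (m i)%:R)) => [|i _]; last by rewrite rX.
rewrite -natr_sum -scalemxAr -scalemxAl; congr (_ *: _).
set S := \sum_i X i *m Theta i *m (Z i)^T.
have KS : (1%:M - H) *m S = 0.
  by rewrite mulmx_sumr big1 // => i _; rewrite !mulmxA K0 !mul0mx.
have SK : S^T *m (1%:M - H) = 0.
  apply: trmx_inj; rewrite trmx_mul trmxK raddfB /= tr_sum_col_proj.
  by rewrite trmx1 KS trmx0.
rewrite /response -/S [(S + E)^T]raddfD /= mulmxDl SK add0r.
rewrite [_ *m (S + E)]mulmxDr -[X in X + _]mulmxA KS.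
by rewrite mulmx0 add0r mulmxBr mulmx1 mulmxBl.
Qed.

Lemma Sigma_hat_error_entry p (q : 'I_k -> nat)
    (Theta : forall i, 'M[R]_(m i, q i)) (Z : forall i, 'M[R]_(p, q i))
    (E : 'M[R]_(n, p)) i j :
  Sigma_hat X (response X Theta Z E) i j =
  (n%:R - (\sum_l m l)%:R)^-1 * ((E^T *m E) i j - (E^T *m H *m E) i j).
Proof.
by rewrite Sigma_hat_error mxE; congr (_ * _); rewrite mxE [X in _ + X]mxE.
Qed.

End SumProj.

(** Apply 2 |x y| <= x^2 + y^2 to each summand of the inner product of two
    columns.  This reduces off-diagonal entries of a Gram matrix, whose sign is
    uncontrolled, to diagonal ones, to which Markov's inequality applies. *)
Lemma gram_entry_le (R : realFieldType) n p (F : 'M[R]_(n, p)) i j :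
  `|(F^T *m F) i j| <= ((F^T *m F) i i + (F^T *m F) j j) / 2.
Proof.
rewrite !mxE -big_split /= mulr_suml; apply: (le_trans (ler_norm_sum _ _ _)).
apply: ler_sum => t _; rewrite !mxE ler_norml.
have := sqr_ge0 (F t i + F t j); have := sqr_ge0 (F t i - F t j).
by move=> h1 h2; apply/andP; split; nra.
Qed.

(** * Expectation of a product of independent variables *)

Section Independence.
Context (R : realType) (d : measure_display) (T : measurableType d).
Context (P : probability T R).
Context d1 d2 (S1 : measurableType d1) (S2 : measurableType d2).

Definition independent_pair (U : T -> S1) (V : T -> S2) : Prop :=
  forall A B, measurable A -> measurable B ->
    P (U @^-1` A `&` V @^-1` B) = (P (U @^-1` A) * P (V @^-1` B))%E.

Context (U : {RV P >-> S1}) (V : {RV P >-> S2}).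

Let W (w : T) : S1 * S2 := (U w, V w).

Let mW : measurable_fun setT W.
Proof. by apply: measurable_fun_pair; exact: measurable_funPT. Qed.

HB.instance Definition _ := isMeasurableFun.Build _ _ _ _ W mW.

Hypothesis UV : independent_pair U V.

(** Both measures agree on rectangles, which determine a measure on the
    product of two sigma-finite spaces. *)
Lemma pair_distribution_indep (C : set (S1 * S2)) : measurable C ->
  (distribution P U \x distribution P V)%E C = distribution P W C.
Proof. by apply: product_measure_unique => A B mA mB; exact: UV. Qed.

Context (g : S1 -> R) (h : S2 -> R).
Hypothesis mg : measurable_fun setT g.
Hypothesis mh : measurable_fun setT h.
Hypothesis ig : P.-integrable setT (EFin \o (g \o U)).
Hypothesis ih : P.-integrable setT (EFin \o (h \o V)).

Let f (z : S1 * S2) := (g z.1 * h z.2)%:E.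

Let mf : measurable_fun setT f.
Proof.
by apply/measurable_EFinP; apply: measurable_funM; exact: measurableT_comp.
Qed.

Let ig' : (distribution P U).-integrable setT (EFin \o g).
Proof. by apply: integrable_pushforward => //; exact/measurable_EFinP. Qed.

Let ih' : (distribution P V).-integrable setT (EFin \o h).
Proof. by apply: integrable_pushforward => //; exact/measurable_EFinP. Qed.

(* By Tonelli, the integral of |g(x) h(y)| is the product of two finite
   integrals. *)
Let iprod : (distribution P U \x distribution P V)%E.-integrable setT f.
Proof.
apply/integrable12ltyP => //.
rewrite (eq_integral (fun x => `|g x|%:E *
   \int[distribution P V]_y `|(h y)%:E|))%E; last first.
  move=> x _; rewrite -ge0_integralZl//=.
  - by apply: eq_integral => y _; rewrite /f /= normrM EFinM.
  - by apply/measurable_EFinP; exact: measurableT_comp.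
have [_ gy] := integrableP _ _ _ ig'; have [_ hy] := integrableP _ _ _ ih'.
rewrite ge0_integralZr//=.
- apply: lte_mul_pinfty => //; first exact: integral_ge0.
  by rewrite ge0_fin_numE // integral_ge0.
- by apply/measurable_EFinP; exact: measurableT_comp.
- exact: integral_ge0.
Qed.

Let iW : (distribution P W).-integrable setT f.
Proof.
apply/integrableP; split => //.
have [_] := integrableP _ _ _ iprod.
rewrite (eq_measure_integral (distribution P W)) // => A mA _.
exact: pair_distribution_indep.
Qed.

Lemma integrable_mul_indep :
  P.-integrable setT (EFin \o (fun w => g (U w) * h (V w))).
Proof.
apply/integrableP; split; first exact: (measurableT_comp mf mW).
have [_] := integrableP _ _ _ iW.
rewrite ge0_integral_distribution //; exact: measurableT_comp.
Qed.

(** Transfer to the joint law of (U, V), which is the product of the marginal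
    laws, and apply Fubini's theorem.  As the factors need only be integrable,
    this applies to unbounded error coordinates. *)
Lemma Rintegral_mul_indep :
  \int[P]_w (g (U w) * h (V w)) = \int[P]_w g (U w) * \int[P]_w h (V w).
Proof.
rewrite /Rintegral -[X in fine X](@integral_distribution _ _ _ _ _ P W f) //;
  last exact: integrable_mul_indep.
rewrite (eq_measure_integral (distribution P U \x distribution P V)%E);
  last by move=> A mA _; apply/esym; exact: pair_distribution_indep.
rewrite -integral12_prod_meas1 //.
have EU : (\int[distribution P U]_x (g x)%:E = \int[P]_w (g (U w))%:E)%E.
  by rewrite integral_distribution //; exact/measurable_EFinP.
have EV : (\int[distribution P V]_x (h x)%:E = \int[P]_w (h (V w))%:E)%E.
  by rewrite integral_distribution //; exact/measurable_EFinP.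
have hfin := integrable_fin_num measurableT ih'.
rewrite (eq_integral (fun x =>
    (g x)%:E * \int[distribution P V]_y (h y)%:E)%E); last first.
  by move=> x _; rewrite -integralZl.
rewrite -(fineK hfin) integralZr // EU EV fineM //=.
exact: (integrable_fin_num measurableT ig).
Qed.

End Independence.

(** * Integrals and probabilities of real random variables *)

Section RealIntegrals.
Context (R : realType) (d : measure_display) (T : measurableType d).
Context (P : probability T R).
Implicit Types f g : T -> R.

Lemma integrable_bigsum (I : Type) (r : seq I) (f : I -> T -> R) :
  (forall i, P.-integrable setT (EFin \o f i)) ->
  P.-integrable setT (EFin \o (fun w => \sum_(i <- r) f i w)).
Proof.
move=> fi.
have := integrable_sum measurableT r (P := xpredT) (fun i _ => fi i).
by apply: eq_integrable => // w _; rewrite /= sumEFin.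
Qed.

Lemma Rintegral_bigsum (I : Type) (r : seq I) (f : I -> T -> R) :
  (forall i, P.-integrable setT (EFin \o f i)) ->
  \int[P]_w (\sum_(i <- r) f i w) = \sum_(i <- r) \int[P]_w f i w.
Proof.
move=> fi; elim: r => [|i r IH].
  rewrite big_nil; under eq_Rintegral do rewrite big_nil.
  by rewrite Rintegral_cst // mul0r.
rewrite big_cons -IH -RintegralD //; last exact: integrable_bigsum.
by under eq_Rintegral do rewrite big_cons.
Qed.

Lemma Rintegral_prob_cst (c : R) : \int[P]_w c = c.
Proof.
rewrite Rintegral_cst // (_ : fine _ = 1) ?mulr1 //.
by rewrite [X in fine X]probability_setT.
Qed.

Lemma integrable_scale a f :
  P.-integrable setT (EFin \o f) ->
  P.-integrable setT (EFin \o (fun w => a * f w)).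
Proof. by move=> fi; have := integrableZl measurableT a fi. Qed.

Lemma integrable_of_bounded f (M : R) : measurable_fun setT f ->
  (forall w, `|f w| <= M) -> P.-integrable setT (EFin \o f).
Proof.
move=> mf fM; apply: measurable_bounded_integrable => //.
  exact: le_lt_trans (probability_le1 P measurableT) (ltry _).
exists M; split; first exact: num_real.
by move=> y My w _; apply: le_trans (fM w) (ltW My).
Qed.

(** On a probability space |f| <= 1 + f^2 suffices, as constants are
    integrable. *)
Lemma integrable_of_sqr f : measurable_fun setT f ->
  P.-integrable setT (EFin \o (fun w => f w ^+ 2)) ->
  P.-integrable setT (EFin \o f).
Proof.
move=> mf f2.
have i1 : P.-integrable setT (EFin \o (cst 1 : T -> R)).
  exact: finite_measure_integrable_cst.
apply: le_integrable (integrableD measurableT i1 f2) => //.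
  exact/measurable_EFinP.
move=> w _ /=; rewrite lee_fin.
rewrite [X in _ <= X]ger0_norm ?addr_ge0 ?sqr_ge0 // ler_norml.
by apply/andP; split; nra.
Qed.

Lemma measurable_gt f (a : R) : measurable_fun setT f ->
  measurable [set w | a < f w].
Proof.
move=> mf; rewrite (_ : [set _ | _] = f @^-1` `]a, +oo[%classic).
  by rewrite -[X in measurable X]setTI; exact: mf.
by apply/seteqP; split => w /=; rewrite in_itv /= andbT.
Qed.

Lemma markov_ge0 f (a : R) : 0 < a -> (forall w, 0 <= f w) ->
  P.-integrable setT (EFin \o f) ->
  (P [set w | (a < f w)%R] <= (\int[P]_w f w / a)%:E)%E.
Proof.
move=> a0 f0 fi.
have mf : measurable_fun setT f.
  by apply/measurable_EFinP; exact: (measurable_int _ fi).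
have h := le_integral_abse P measurableT (measurable_int _ fi) a0.
have eI : (\int[P]_w `|(EFin \o f) w| = (\int[P]_w f w)%:E)%E.
  rewrite /Rintegral fineK; last exact: integrable_fin_num.
  by apply: eq_integral => w _ /=; rewrite ger0_norm.
rewrite eI setTI in h.
rewrite mulrC EFinM lee_pdivlMl //; apply: le_trans h.
apply: lee_pmul => //; first by rewrite lee_fin ltW.
apply: le_measure; rewrite ?inE.
- exact: measurable_gt.
- rewrite -[X in measurable X]setTI; apply: emeasurable_fun_c_infty => //.
  by apply: measurableT_comp => //; exact/measurable_EFinP.
- by move=> w /= aw; rewrite lee_fin ger0_norm // ltW.
Qed.

Lemma measure_le_setU (A B C : set T) : measurable A -> measurable B ->
  measurable C -> A `<=` B `|` C -> (P A <= P B + P C)%E.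
Proof.
move=> mA mB mC ABC; apply: (@le_trans _ _ (P (B `|` C))).
  by apply: le_measure; rewrite ?inE //; exact: measurableU.
exact: measureU2.
Qed.

Lemma cvge_0_le (u : nat -> \bar R) : (forall n, 0 <= u n)%E ->
  (forall e : R, 0 < e -> \forall n \near \oo, (u n <= e%:E)%E) ->
  u @ \oo --> 0%E.
Proof.
move=> u0 ule; apply/fine_cvgP; split.
  apply: filterS (ule 1 ltr01) => n un.
  by rewrite ge0_fin_numE // (le_lt_trans un) ?ltry.
apply/cvgrPdist_le => e e0; apply: filterS (ule e e0) => n un.
rewrite sub0r normrN /= ger0_norm ?fine_ge0 // -lee_fin fineK //.
by rewrite ge0_fin_numE // (le_lt_trans un) ?ltry.
Qed.

End RealIntegrals.

(** * Independent and identically distributed sequences *)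

Section IidSequence.
Context (R : realType) (d : measure_display) (T : measurableType d).
Context (P : probability T R) (d' : measure_display) (S : measurableType d').
Context (xi : nat -> {RV P >-> S}).
Hypothesis indep : forall s t, s != t -> independent_pair P (xi s) (xi t).

(** Independence and centering cancel the off-diagonal terms, so only the
    trace of the coefficient matrix matters, whatever its size. *)
Lemma quadratic_form_expectation (n : nat) (H : 'M[R]_n) (g : S -> R) (v : R) :
  measurable_fun setT g ->
  (forall t, P.-integrable setT (EFin \o (fun w => g (xi t w) ^+ 2))) ->
  (forall t, \int[P]_w g (xi t w) = 0) ->
  (forall t, \int[P]_w (g (xi t w) ^+ 2) = v) ->
  let Q w := \sum_(s < n) \sum_(t < n) H s t * (g (xi s w) * g (xi t w)) in
  P.-integrable setT (EFin \o Q) /\ \int[P]_w Q w = v * \tr H.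
Proof.
move=> mg g2 g0 gv Q.
have mgxi t : measurable_fun setT (g \o xi t) by exact: measurableT_comp.
have ig t : P.-integrable setT (EFin \o (g \o xi t)).
  exact: (integrable_of_sqr (mgxi t) (g2 t)).
have igg s t : P.-integrable setT (EFin \o (fun w => g (xi s w) * g (xi t w))).
  have [->|st] := eqVneq s t.
    by apply: eq_integrable (g2 t) => // w _; rewrite /= expr2.
  by apply: integrable_mul_indep => //; exact: indep.
have Igg s t : \int[P]_w (g (xi s w) * g (xi t w)) = v * (s == t)%:R.
  have [->|st] := eqVneq s t.
    by rewrite mulr1 -(gv t); apply: eq_Rintegral => w _; rewrite expr2.
  by rewrite Rintegral_mul_indep ?g0 ?mulr0 //; exact: indep.
split.
  by do 2 (apply: integrable_bigsum => ?); exact: integrable_scale.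
rewrite Rintegral_bigsum => [|s]; last first.
  by apply: integrable_bigsum => t; exact: integrable_scale.
rewrite /mxtrace mulr_sumr; apply: eq_bigr => s _.
rewrite Rintegral_bigsum => [|t]; last exact: integrable_scale.
rewrite (bigD1 s) //= big1 ?addr0 => [|t ts].
  by rewrite RintegralZl // Igg eqxx mulr1 mulrC.
by rewrite RintegralZl // Igg -val_eqE in ts *;
   rewrite eq_sym (negbTE ts) !mulr0.
Qed.

Hypothesis idd : forall s t B, measurable B ->
  P (xi s @^-1` B) = P (xi t @^-1` B).

Lemma id_integral s t (f : S -> \bar R) : measurable_fun setT f ->
  (forall x, 0 <= f x)%E ->
  (\int[P]_w f (xi s w) = \int[P]_w f (xi t w))%E.
Proof.
move=> mf f0.
rewrite -!(@ge0_integral_distribution _ _ _ _ _ P _ f) //.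
by apply: eq_measure_integral => A mA _; exact: idd.
Qed.

Lemma id_integrable s t (g : S -> R) : measurable_fun setT g ->
  P.-integrable setT (EFin \o (g \o xi s)) ->
  P.-integrable setT (EFin \o (g \o xi t)).
Proof.
move=> mg /integrableP[_ gs]; apply/integrableP; split.
  by apply/measurable_EFinP; exact: measurableT_comp.
rewrite (id_integral t s (f := fun x => `|(g x)%:E|%E)) //.
by apply/measurable_EFinP; exact: measurableT_comp.
Qed.

Lemma id_Rintegral s t (g : S -> R) : measurable_fun setT g ->
  P.-integrable setT (EFin \o (g \o xi s)) ->
  \int[P]_w g (xi s w) = \int[P]_w g (xi t w).
Proof.
move=> mg gs; have gt := id_integrable t mg gs.
have mg' : measurable_fun setT (EFin \o g) by exact/measurable_EFinP.
rewrite /Rintegral; congr fine.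
rewrite -!(@integral_distribution _ _ _ _ _ P _ (EFin \o g)) //.
by apply: eq_measure_integral => A mA _; exact: idd.
Qed.

End IidSequence.

(** * The weak law of large numbers *)

Section WeakLaw.
Import HBSimple.
Context (R : realType) (d : measure_display) (T : measurableType d).
Context (P : probability T R) (d' : measure_display) (S : measurableType d').

(** Simple functions are dense in L1 of the law of X, and they are bounded.  The
    approximant is a function h on the state space, not on the sample space:
    the same h can then be applied to every term of a sequence with the law of
    X. *)
Lemma simple_approximation (X : {RV P >-> S}) (g : S -> R) (e : R) : 0 < e ->
  measurable_fun setT g -> P.-integrable setT (EFin \o (g \o X)) ->
  exists h : S -> R,
  [/\ measurable_fun setT h, (exists M, forall x, `|h x| <= M),
    P.-integrable setT (EFin \o (fun w => `|g (X w) - h (X w)|)) &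
    \int[P]_w `|g (X w) - h (X w)| <= e].
Proof.
move=> e0 mg ig.
have ig' : (distribution P X).-integrable setT (EFin \o g).
  by apply: integrable_pushforward => //; exact/measurable_EFinP.
have [h_ [_ _ /fine_cvgP[hfin hcvg]]] :=
  approximation_sfun_integrable measurableT ig'.
have /cvgrPdist_le /(_ e e0) hle := hcvg.
pose I n := (\int[distribution P X]_z `|(EFin \o g) z - (h_ n z)%:E|)%E.
near \oo => n.
have h1 : I n \is a fin_num by near: n; exact: hfin.
have h2 : `|0 - fine (I n)| <= e by near: n; exact: hle.
exists (h_ n).
have mgh : measurable_fun setT (fun x => g x - h_ n x).
  by apply: measurable_funB => //; exact: measurable_funPT.
have eI : I n = (\int[P]_w `|(g (X w) - h_ n (X w))%:E|)%E.
  rewrite /I ge0_integral_distribution //.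
  apply: (@measurableT_comp _ _ _ _ _ _ abse) => //.
  exact/measurable_EFinP.
have igh : P.-integrable setT (EFin \o (fun w => `|g (X w) - h_ n (X w)|)).
  apply/integrableP; split.
    apply/measurable_EFinP; apply: measurableT_comp => //.
    exact: (measurableT_comp mgh).
  under eq_integral do rewrite /= normr_id.
  by rewrite -[X in (X < _)%E]eI -ge0_fin_numE // integral_ge0.
split => //.
  have [M [_ hM]] := simple_bounded (h_ n).
  by exists (M + 1) => x; apply: hM => //; rewrite ltrDl.
apply: le_trans h2; rewrite sub0r normrN eI.
by rewrite /Rintegral ger0_norm // fine_ge0 // integral_ge0.
Unshelve. all: end_near. Qed.

Context (xi : nat -> {RV P >-> S}).
Hypothesis indep : forall s t, s != t -> independent_pair P (xi s) (xi t).
Hypothesis idd : forall s t B, measurable B ->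
  P (xi s @^-1` B) = P (xi t @^-1` B).

(** Chebyshev's inequality.  Boundedness of h provides the variance v, and the
    quadratic form with all coefficients 1, of trace n, is the square of the
    centered sum. *)
Lemma centered_sum_tail_bounded (h : S -> R) (M : R) : measurable_fun setT h ->
  (forall x, `|h x| <= M) ->
  exists v : R, forall n (a : R), 0 < a ->
  (P [set w | (a < `|\sum_(t < n) (h (xi t w) - \int[P]_w h (xi 0%N w))|)%R]
     <= (v * n%:R / a ^+ 2)%:E)%E.
Proof.
move=> mh hM; set c := \int[P]_w _.
pose g x := h x - c.
have mg : measurable_fun setT g by exact: measurable_funB.
have ih t : P.-integrable setT (EFin \o (h \o xi t)).
  apply: (@integrable_of_bounded _ _ _ P (h \o xi t) M) => [|w].
    exact: measurableT_comp.
  exact: hM.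
have ig2 t : P.-integrable setT (EFin \o (fun w => g (xi t w) ^+ 2)).
  apply: (@integrable_of_bounded _ _ _ P _ ((M + `|c|) ^+ 2)).
    by apply: measurable_funX; apply: (measurableT_comp mg).
  move=> w; have M0 : 0 <= M := le_trans (normr_ge0 _) (hM (xi t w)).
  rewrite normrX lerXn2r ?nnegrE ?addr_ge0 //.
  by rewrite (le_trans (ler_normB _ _)) // lerD2r.
have g0 t : \int[P]_w g (xi t w) = 0.
  rewrite RintegralB //; [|exact: ih|exact: finite_measure_integrable_cst].
  by rewrite (id_Rintegral idd 0%N) // -/c Rintegral_prob_cst subrr.
pose v := \int[P]_w (g (xi 0%N w) ^+ 2).
have gv t : \int[P]_w (g (xi t w) ^+ 2) = v.
  have mg2 : measurable_fun setT (fun x => g x ^+ 2) by exact: measurable_funX.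
  exact: (id_Rintegral idd 0%N mg2 (ig2 t)).
exists v => n a a0.
pose J : 'M[R]_n := const_mx 1.
have [iQ EQ] := quadratic_form_expectation indep J mg ig2 g0 gv.
have QE w : (\sum_(t < n) g (xi t w)) ^+ 2 =
  \sum_(s < n) \sum_(t < n) J s t * (g (xi s w) * g (xi t w)).
  rewrite expr2 big_distrlr /=; apply: eq_bigr => s _; apply: eq_bigr => t _.
  by rewrite mxE mul1r.
have trn : \tr J = n%:R.
  rewrite /mxtrace; under eq_bigr do rewrite mxE.
  by rewrite sumr_const card_ord.
rewrite trn in EQ.
have -> : [set w | (a < `|\sum_(t < n) (h (xi t w) - c)|)%R] =
    [set w | (a ^+ 2 <
      \sum_(s < n) \sum_(t < n) J s t * (g (xi s w) * g (xi t w)))%R].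
  apply/eq_set => w; rewrite -QE.
  rewrite -[X in _ = is_true (_ < X)]real_normK ?num_real //.
  by rewrite ltr_sqr // nnegrE ltW.
rewrite -EQ; apply: markov_ge0 => //; first by rewrite exprn_gt0.
by move=> w; rewrite -QE sqr_ge0.
Qed.

(** Khinchin's weak law, for pairwise independent terms.  Approximate g in L1
    by a bounded h, with error at most eta, and write the centered sum of g as
    the centered sum of h, plus the sum of g - h, plus n times the difference of
    the means.  Chebyshev's inequality controls the first term, Markov's
    inequality the second, and the third is at most n eta.  A single h, chosen
    before n, suffices. *)
Lemma weak_law (g : S -> R) : measurable_fun setT g ->
  P.-integrable setT (EFin \o (g \o xi 0%N)) ->
  forall e : R, 0 < e ->
  P [set w | e * n%:R < `|\sum_(t < n) (g (xi t w) - \int[P]_w g (xi 0%N w))|]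
    @[n --> \oo] --> 0%E.
Proof.
move=> mg ig e e0; set mu := \int[P]_w _.
apply: cvge_0_le => // D D0.
(* The bound e / 2 keeps the difference of the means below half of the allowed
   deviation; e D / 8 makes Markov's inequality, applied at level n e / 4 to a
   sum with expectation at most n eta, contribute at most D / 2. *)
pose eta := Num.min (e / 2) (e * D / 8).
have eta0 : 0 < eta by rewrite lt_min !divr_gt0 ?mulr_gt0.
have [h [mh [M hM] igh hle]] := simple_approximation eta0 mg ig.
have [v hv] := centered_sum_tail_bounded mh hM.
pose c := \int[P]_w h (xi 0%N w).
have mgh : measurable_fun setT (fun x => `|g x - h x|).
  by apply: measurableT_comp => //; exact: measurable_funB.
have ih : P.-integrable setT (EFin \o (h \o xi 0%N)).
  apply: (@integrable_of_bounded _ _ _ P (h \o xi 0%N) M) => [|w].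
    exact: measurableT_comp.
  exact: hM.
have cmu : `|c - mu| <= eta.
  rewrite distrC -RintegralB //.
  apply: le_trans hle; apply: le_normr_Rintegral => //.
  by have := integrableB measurableT ig ih.
have igh' t :
    P.-integrable setT (EFin \o (fun w => `|g (xi t w) - h (xi t w)|)).
  exact: (id_integrable idd t mgh igh).
have Igh t : \int[P]_w `|g (xi t w) - h (xi t w)| <= eta.
  by rewrite (id_Rintegral idd 0%N mgh (igh' t)).
near=> n.
have n0 : (0 < n)%N by near: n; exact: nbhs_infty_gt.
have nR : 0 < n%:R :> R by rewrite ltr0n.
(* Chebyshev's bound at level n e / 4 is 16 v / (n e^2); this makes it at most
   D / 2. *)
have nv : 32 * v / (e ^+ 2 * D) <= n%:R by near: n; exact: nbhs_infty_ger.
have a0 : 0 < n%:R * e / 4 by rewrite divr_gt0 // mulr_gt0.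
have mA : measurable
    [set w | e * n%:R < `|\sum_(t < n) (g (xi t w) - mu)|].
  apply: measurable_gt; apply: measurableT_comp => //.
  apply: measurable_sum => t.
  by apply: measurable_funB => //; exact: measurableT_comp.
have mB : measurable
    [set w | n%:R * e / 4 < `|\sum_(t < n) (h (xi t w) - c)|].
  apply: measurable_gt; apply: measurableT_comp => //.
  apply: measurable_sum => t.
  by apply: measurable_funB => //; exact: measurableT_comp.
have mC : measurable
    [set w | n%:R * e / 4 < \sum_(t < n) `|g (xi t w) - h (xi t w)|].
  apply: measurable_gt; apply: measurable_sum => t.
  exact: (measurableT_comp mgh).
apply: (le_trans (measure_le_setU P mA mB mC _)).
  move=> w /= ew; apply/orP; rewrite -implyNb -leNgt; apply/implyP => Bw.
  rewrite ltNge; apply/negP => Cw; move: ew; apply/negP; rewrite -leNgt.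
  rewrite (eq_bigr (fun t : 'I_n => (h (xi t w) - c) +
    (g (xi t w) - h (xi t w)) + (c - mu))); last by move=> t _; ring.
  rewrite big_split big_split /= sumr_const card_ord.
  apply: (le_trans (ler_normD _ _)); rewrite normrMn.
  have H1 := le_trans
    (ler_normD (\sum_(t < n) (h (xi t w) - c))
               (\sum_(t < n) (g (xi t w) - h (xi t w))))
    (lerD Bw (le_trans (ler_norm_sum _ _ _) Cw)).
  have H2 : `|c - mu| *+ n <= n%:R * e / 2.
    rewrite -[_ *+ n]mulr_natl -mulrA ler_wpM2l //; apply: (le_trans cmu).
    by rewrite ge_min lexx.
  by apply: (le_trans (lerD H1 H2)); lra.
rewrite (_ : D = D / 2 + D / 2); last by lra.
rewrite EFinD; apply: leeD.
  apply: (le_trans (hv n _ a0)); rewrite lee_fin.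
  rewrite ler_pdivrMr ?exprn_gt0 //.
  move: nv; rewrite ler_pdivrMr ?mulr_gt0 ?exprn_gt0 // => nv.
  rewrite [leRHS](_ : _ = n%:R * (n%:R * (e ^+ 2 * D)) / 32); last by field.
  by rewrite ler_pdivlMr // mulrAC [X in X <= _]mulrC ler_wpM2l // mulrC.
apply: (le_trans (markov_ge0 a0 _ _)).
- by move=> w; exact: sumr_ge0.
- exact: integrable_bigsum.
rewrite lee_fin Rintegral_bigsum // ler_pdivrMr //.
apply: (@le_trans _ _ (\sum_(t < n) eta)); first exact: ler_sum.
rewrite sumr_const card_ord -[eta *+ n]mulr_natl.
rewrite [leRHS](_ : _ = n%:R * (e * D / 8)); last by field.
by rewrite ler_wpM2l // ge_min lexx orbT.
Unshelve. all: end_near. Qed.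

End WeakLaw.

(** * Random matrices *)

(** Coordinates are continuous, and the open intervals generate the Borel sets
    of the line. *)
Lemma measurable_coord (R : realType) m n (i : 'I_m) (j : 'I_n) :
  measurable_fun [set: borel_mx R m n]
    (fun v : borel_mx R m n => (v : 'M[R]_(m, n)) i j).
Proof.
apply: (measurability _ (RGenOpens.measurableE R)).
move=> _ [_ [a [b ->] <-]]; rewrite setTI.
apply: sub_sigma_algebra.
have /continuousP := @coord_continuous R m n i j; apply.
exact: interval_open.
Qed.

Section Matrices.
Context (R : realType) (d : measure_display) (T : measurableType d).
Context (P : probability T R).

Lemma mutually_independent_pair (m n : nat) (I : choiceType)
    (xi : I -> T -> borel_mx R m n) (s t : I) :
  mutually_independent P xi -> s != t -> independent_pair P (xi s) (xi t).
Proof.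
move=> ind st A B mA mB.
(* The product rule over a pair is read off a family of events indexed by all
   of I, of which only the values at s and t count. *)
pose C i : set (borel_mx R m n) := if i == s then A else B.
have mC i : measurable (C i) by rewrite /C; case: ifP.
have := ind [fset s; t]%fset C mC.
rewrite big_fsetU1 /= ?inE // big_seq_fset1 /C eqxx eq_sym (negbTE st) => <-.
congr (P _); apply/seteqP; split => w /=.
  move=> [As Bt] i /=; rewrite !inE => /orP[] /eqP ->; rewrite ?eqxx //.
  by rewrite eq_sym (negbTE st).
move=> h; split.
  by have := h s; rewrite /= !inE eqxx; apply.
by have := h t; rewrite /= !inE eqxx orbT eq_sym (negbTE st); apply.
Qed.

Lemma mx_norm_gt_entry (m n : nat) (M : 'M[R]_(m, n)) (e : R) : 0 <= e ->
  e < `|M| -> exists i j, e < `|M i j|.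
Proof.
move=> e0 eM; apply: contrapT => H; move: eM; apply/negP; rewrite -leNgt.
rewrite -[leLHS]/(mx_norm M) mx_normrE.
apply/bigmax_leP; split => // -[i j] _ /=.
by rewrite leNgt; apply/negP => h; apply: H; exists i, j.
Qed.

Lemma mx_entry_le_norm (m n : nat) (M : 'M[R]_(m, n)) i j : `|M i j| <= `|M|.
Proof.
rewrite -[leRHS]/(mx_norm M) mx_normrE.
exact: (le_bigmax _ (fun ij : 'I_m * 'I_n => `|M ij.1 ij.2|) (i, j)).
Qed.

Lemma measure_bigsetU_le (I : Type) (r : seq I) (A : I -> set T) :
  (forall i, measurable (A i)) ->
  (P (\big[setU/set0]_(i <- r) A i) <= \sum_(i <- r) P (A i))%E.
Proof.
move=> mA; elim: r => [|i r IH]; first by rewrite !big_nil measure0.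
rewrite !big_cons.
apply: (@le_trans _ _ (P (A i) + P (\big[setU/set0]_(i <- r) A i))%E).
  apply: measureU2 => //; exact: bigsetU_measurable.
exact: leeD2l.
Qed.

(** The matrix norm is the largest absolute value of an entry, so a deviation of
    the matrix is the union of finitely many deviations of entries. *)
Lemma cvg_in_probability_entries (m n : nat) (X : nat -> T -> 'M[R]_(m, n))
    (L : 'M[R]_(m, n)) :
  (forall N i j, measurable_fun setT (fun w => X N w i j)) ->
  (forall i j (e : R), 0 < e ->
    P [set w | e < `|X N w i j - L i j|] @[N --> \oo] --> 0%E) ->
  cvg_in_probability P X L.
Proof.
move=> mX cX e e0; apply: cvge_0_le => // D D0.
pose A N (ij : 'I_m * 'I_n) := [set w | e < `|X N w ij.1 ij.2 - L ij.1 ij.2|].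
have mA N ij : measurable (A N ij).
  apply: measurable_gt; apply: measurableT_comp => //.
  exact: measurable_funB.
(* The successor keeps K positive for matrices without entries. *)
pose K : R := #|{: 'I_m * 'I_n}|.+1%:R.
have K0 : 0 < K by rewrite ltr0n.
have nearA : \forall N \near \oo, forall ij, (P (A N ij) <= (D / K)%:E)%E.
  apply: filter_forall => ij.
  have /fine_cvgP[Afin /cvgrPdist_le /(_ (D / K)) Acvg] := cX ij.1 ij.2 e e0.
  near=> N.
  have h1 : P (A N ij) \is a fin_num by near: N; exact: Afin.
  have h2 : `|0 - fine (P (A N ij))| <= D / K.
    by near: N; apply: Acvg; rewrite divr_gt0.
  by rewrite -(fineK h1) lee_fin (le_trans _ h2) // sub0r normrN ler_norm.
apply: filterS nearA => N NA.
apply: (@le_trans _ _ (P (\big[setU/set0]_ij A N ij))).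
  have EA : [set w | e < `|X N w - L|] = \big[setU/set0]_ij A N ij.
    rewrite -bigcup_seq; apply/seteqP; split => w /=.
      move=> /(mx_norm_gt_entry (ltW e0)) [i [j]]; rewrite !mxE => h.
      by exists (i, j) => //=; rewrite mem_index_enum.
    move=> [[i j] _] /= h; apply: lt_le_trans h _.
    by have := mx_entry_le_norm (X N w - L) i j; rewrite !mxE.
  by rewrite EA.
apply: (le_trans (measure_bigsetU_le _ (mA N))).
apply: (@le_trans _ _ (\sum_(ij : 'I_m * 'I_n) (D / K)%:E)%E).
  exact: lee_sum.
rewrite sumEFin lee_fin sumr_const -[_ *+ _]mulr_natl mulrCA ger_pMr //.
by rewrite ler_pdivrMr // mul1r ler_nat.
Unshelve. all: end_near. Qed.

End Matrices.

(** * The residual estimator *)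

Lemma measurable_Sigma_hat_entry (R : realType) d (T : measurableType d)
    (n p k : nat) (m : 'I_k -> nat) (X : forall i, 'M[R]_(n, m i))
    (Y : T -> 'M[R]_(n, p)) i j :
  (forall t l, measurable_fun setT (fun w => Y w t l)) ->
  measurable_fun setT (fun w => Sigma_hat X (Y w) i j).
Proof.
move=> mY.
apply: (eq_measurable_fun (fun w =>
  \sum_s (\sum_t Y w t i * resid_W X t s) * Y w s j)).
  move=> w _; rewrite /Sigma_hat [RHS]mxE; apply: eq_bigr => s _.
  rewrite [in RHS]mxE; congr (_ * _); apply: eq_bigr => t _.
  by rewrite [_^T _ _]mxE.
apply: measurable_sum => s; apply: measurable_funM => //.
by apply: measurable_sum => t; exact: measurable_funM.
Qed.

(** The deterministic part of the argument, for one entry: S is the entry of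
    E' E, s that of Sigma and b that of E' H E.  Multiplied by n - M >= n / 2,
    the deviation is (S - n s) - b + M s, and each of the three terms is at most
    e n / 8. *)
Lemma error_bound (R : realType) (n M S s e b q : R) :
  0 < n -> 2 * M <= n -> 0 < e -> 8 * `|M * s| <= e * n ->
  `|S - n * s| <= e / 8 * n -> q <= e / 8 * n -> `|b| <= q ->
  `|(n - M)^-1 * (S - b) - s| <= e.
Proof.
move=> n0 Mn e0 Ms HS Hq Hb.
have r0 : 0 < n - M by lra.
rewrite (_ : _ - s = (n - M)^-1 * ((S - n * s) - b + M * s));
  last by field; lra.
rewrite normrM gtr0_norm ?invr_gt0 // mulrC ler_pdivrMr //.
apply: (le_trans (ler_normD _ _)).
apply: (le_trans (lerD (ler_normB _ _) (lexx _))).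
by nra.
Qed.

Section ErrorRows.
Context (R : realType) (d : measure_display) (T : measurableType d).
Context (P : probability T R) (p : nat) (Sigma : 'M[R]_p).
Context (eps : nat -> {RV P >-> borel_mx R 1 p}).

Let coord (j : 'I_p) (v : borel_mx R 1 p) : R := (v : 'rV[R]_p) ord0 j.

Hypothesis hmean : forall (t : nat) (j : 'I_p),
     ('E_P[fun w => (eps t w : 'rV[R]_p) ord0 j] = 0)%E.
Hypothesis hcov : forall (t : nat) (i j : 'I_p),
     covariance P (fun w => (eps t w : 'rV[R]_p) ord0 i)
                  (fun w => (eps t w : 'rV[R]_p) ord0 j) = (Sigma i j)%:E.

Lemma measurable_error_entry t j :
  measurable_fun setT (fun w => coord j (eps t w)).
Proof.
by apply: measurableT_comp; [exact: measurable_coord|exact: measurable_funPT].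
Qed.

Lemma error_mean t j : \int[P]_w coord j (eps t w) = 0.
Proof. by have := hmean t j; rewrite unlock /Rintegral => ->. Qed.

(* The errors are centered, so their covariances are mixed second moments. *)
Let covE t i j :
  (\int[P]_w (coord i (eps t w) * coord j (eps t w))%:E = (Sigma i j)%:E)%E.
Proof.
rewrite -(hcov t i j) !unlock; apply: eq_integral => w _.
have := hmean t i; have := hmean t j; rewrite unlock => -> -> /=.
by rewrite -[(_ * _) w]/((_ w) * (_ w)) /= !subr0.
Qed.

(** A finite value of the extended integral forces integrability, as an infinite
    positive or negative part would give an infinite value. *)
Lemma error_product_integrable t i j :
  P.-integrable setT (EFin \o (fun w => coord i (eps t w) * coord j (eps t w))).
Proof.
have mf : measurable_fun setT (fun w => coord i (eps t w) * coord j (eps t w)).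
  by apply: measurable_funM; exact: measurable_error_entry.
apply/integrableP; split; first exact/measurable_EFinP.
by rewrite integral_fin_num_abs // covE.
Qed.

Lemma error_cov t i j :
  \int[P]_w (coord i (eps t w) * coord j (eps t w)) = Sigma i j.
Proof. by rewrite /Rintegral covE. Qed.

Hypothesis hind : mutually_independent P (fun t w => eps t w).
Hypothesis hid : identically_distributed P (fun t w => eps t w).

Let indep s t : s != t -> independent_pair P (eps s) (eps t).
Proof. by move=> st; exact: (mutually_independent_pair hind). Qed.

Let E n w := first_rows (fun t => (eps t w : 'rV[R]_p)) n.

Lemma cross_product_lln i j (e : R) : 0 < e ->
  P [set w | e * n%:R < `|((E n w)^T *m E n w) i j - n%:R * Sigma i j|]
    @[n --> \oo] --> 0%E.
Proof.
move=> e0.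
have mg : measurable_fun setT (fun v => coord i v * coord j v).
  by apply: measurable_funM; exact: measurable_coord.
have := weak_law indep hid mg (error_product_integrable 0%N i j) e0.
rewrite error_cov; apply: cvg_trans; apply: near_eq_cvg; near=> n.
congr (P _); apply/eq_set => w; congr (is_true (_ < `|_|)).
rewrite big_split /= sumr_const card_ord mulNrn mulr_natl mxE; congr (_ - _).
by apply: eq_bigr => t _; rewrite !mxE.
Unshelve. all: end_near. Qed.

Lemma projected_error_expectation n (H : 'M[R]_n) j :
  let q w := ((E n w)^T *m H *m E n w) j j in
  P.-integrable setT (EFin \o q) /\ \int[P]_w q w = Sigma j j * \tr H.
Proof.
move=> q.
have ig2 t : P.-integrable setT (EFin \o (fun w => coord j (eps t w) ^+ 2)).
  exact: error_product_integrable.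
have gv t : \int[P]_w (coord j (eps t w) ^+ 2) = Sigma j j by exact: error_cov.
have := quadratic_form_expectation indep H (@measurable_coord R 1 p ord0 j) ig2
  (fun t => error_mean t j) gv.
rewrite (_ : (fun w => _) = q) //.
apply/funext => w; rewrite /q mxE exchange_big /=; apply: eq_bigr => s _.
rewrite mxE mulr_suml; apply: eq_bigr => t _; rewrite !mxE.
by rewrite /coord; ring.
Qed.

End ErrorRows.

Theorem theorem3p1 (R : realType) (d : measure_display) (T : measurableType d)
    (P : probability T R) (k p n0 : nat) (m q : 'I_k -> nat)
    (x : forall i : 'I_k, nat -> 'rV[R]_(m i))
    (Theta : forall i : 'I_k, 'M[R]_(m i, q i))
    (Z : forall i : 'I_k, 'M[R]_(p, q i))
    (Sigma : 'M[R]_p)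
    (eps : nat -> {RV P >-> borel_mx R 1 p})
    (X := fun (n : nat) (i : 'I_k) => first_rows (x i) n)
    (E := fun (n : nat) (w : T) => first_rows (fun t => eps t w) n)
    (Y := fun (n : nat) (w : T) => response (X n) Theta Z (E n w)) :
  (0 < k)%N ->
  (forall i : 'I_k, (q i < p)%N /\ \rank (Z i) = q i) ->
  (forall (n : nat) (i : 'I_k), (n0 <= n)%N ->
     [/\ (m i < n)%N, \rank (X n i) = m i & (\rank (X n i) + p <= n)%N]) ->
  (forall (n : nat) (i j : 'I_k), (n0 <= n)%N -> i != j ->
     (X n i)^T *m X n j = 0) ->
  (forall n : nat, (n0 <= n)%N -> continuous_type P (E n)) ->
  mutually_independent P (fun t w => eps t w) ->
  identically_distributed P (fun t w => eps t w) ->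
  (forall (t : nat) (j : 'I_p),
     ('E_P[fun w => (eps t w : 'rV[R]_p) ord0 j] = 0)%E) ->
  (forall (t : nat) (i j : 'I_p),
     covariance P (fun w => (eps t w : 'rV[R]_p) ord0 i)
                  (fun w => (eps t w : 'rV[R]_p) ord0 j) = (Sigma i j)%:E) ->
  cvg_in_probability P (fun n w => Sigma_hat (X n) (Y n w)) Sigma.
Proof.
move=> k0 rankZ hX orthX contE ind idd mean cov.
pose Q n w i := ((E n w)^T *m (\sum_l col_proj (X n l)) *m E n w) i i.
have mE n t l : measurable_fun setT (fun w => E n w t l).
  apply: (eq_measurable_fun (fun w => (eps t w : 'rV[R]_p) ord0 l)).
    by move=> w _; rewrite mxE.
  exact: measurable_error_entry.
have mS n i j : measurable_fun setT (fun w => Sigma_hat (X n) (Y n w) i j).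
  apply: measurable_Sigma_hat_entry => t l.
  rewrite /Y /response; under eq_fun do rewrite mxE.
  exact: measurable_funD.
apply: cvg_in_probability_entries => // i j e e0.
apply: cvge_0_le => // D D0.
pose M : R := (\sum_l m l)%:R.
have e80 : 0 < e / 8 by rewrite divr_gt0.
pose A n := [set w |
  e / 8 * n%:R < `|((E n w)^T *m E n w) i j - n%:R * Sigma i j|].
have lln := cross_product_lln mean cov ind idd i j e80.
have /fine_cvgP[Afin /cvgrPdist_le /(_ (D / 2)) Acvg] := lln.
near=> n.
have n_ge : (n0 <= n)%N by near: n; exact: nbhs_infty_ge.
have n_gt0 : 0 < n%:R :> R by rewrite ltr0n; near: n; exact: nbhs_infty_gt.
have nM : 2 * M <= n%:R by near: n; exact: nbhs_infty_ger.
have nS : 8 * `|M * Sigma i j| / e <= n%:R.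
  by near: n; exact: nbhs_infty_ger.
(* Markov's bound at level e n / 8 for a variable B with expectation
   (Sigma_ii + Sigma_jj) M / 2; this makes it at most D / 2. *)
have nQ : 8 * ((Sigma i i + Sigma j j) * M) / (e * D) <= n%:R.
  by near: n; exact: nbhs_infty_ger.
have rX l : \rank (X n l) = m l by have [] := hX n l n_ge.
have oX l l' : l != l' -> (X n l)^T *m X n l' = 0 by exact: orthX.
pose H := \sum_l col_proj (X n l).
have trH : \tr H = M by exact: mxtrace_sum_col_proj.
have qE w : (E n w)^T *m H *m E n w = (H *m E n w)^T *m (H *m E n w).
  rewrite trmx_mul tr_sum_col_proj // !mulmxA -(mulmxA _ H H).
  by rewrite sum_col_proj_idem.
have q0 w l : 0 <= Q n w l.
  rewrite /Q -/H qE mxE; apply: sumr_ge0 => t _.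
  by rewrite [_^T _ _]mxE -expr2 sqr_ge0.
have [iqi Eqi] := projected_error_expectation mean cov ind H i.
have [iqj Eqj] := projected_error_expectation mean cov ind H j.
(* By [gram_entry_le], B dominates the absolute value of the entry (i, j) of
   E' H E. *)
pose B w := 2^-1 * (Q n w i + Q n w j).
have iB : P.-integrable setT (EFin \o B).
  apply: integrable_scale; exact: (integrableD measurableT iqi iqj).
have EB : \int[P]_w B w = (Sigma i i + Sigma j j) * M / 2.
  rewrite RintegralZl //; last exact: (integrableD measurableT iqi iqj).
  by rewrite RintegralD // Eqi Eqj trH -mulrDl mulrC.
have mB : measurable_fun setT B.
  by apply/measurable_EFinP; exact: (measurable_int _ iB).
apply: (le_trans (measure_le_setU P _ _ _
  (B := A n) (C := [set w | e / 8 * n%:R < B w]) _)).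
- apply: measurable_gt; apply: measurableT_comp => //.
  exact: measurable_funB.
- apply: measurable_gt; apply: measurableT_comp => //.
  apply: measurable_funB => //.
  under eq_fun do rewrite mxE.
  apply: measurable_sum => t; apply: measurable_funM => //.
  by under eq_fun do rewrite mxE; exact: mE.
- exact: measurable_gt.
- move=> w /= ew; apply/orP; rewrite -implyNb -leNgt; apply/implyP => Aw.
  rewrite ltNge; apply/negP => Bw; move: ew; apply/negP; rewrite -leNgt.
  rewrite Sigma_hat_error_entry // -/H -/M.
  apply: (error_bound n_gt0 nM e0 _ Aw Bw).
    by move: nS; rewrite ler_pdivrMr // [n%:R * e]mulrC.
  rewrite /B mulrC /Q -/H qE; exact: gram_entry_le.
rewrite (_ : D = D / 2 + D / 2); last by lra.
rewrite EFinD; apply: leeD.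
  have h1 : P (A n) \is a fin_num by near: n; exact: Afin.
  rewrite -(fineK h1) lee_fin -[X in X <= _]ger0_norm ?fine_ge0 //.
  rewrite -normrN -sub0r.
  by near: n; apply: Acvg; rewrite divr_gt0.
apply: (le_trans (markov_ge0 _ _ iB)).
- by rewrite mulr_gt0.
- by move=> w; rewrite mulr_ge0 ?invr_ge0 // addr_ge0.
rewrite lee_fin EB ler_pdivrMr ?mulr_gt0 //.
by move: nQ; rewrite ler_pdivrMr ?mulr_gt0 //; lra.
Unshelve. all: end_near. Qed.
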